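(* For every positive integer $n$ there is a permutation of length $22n^{3/2}+\Theta(n)$ that contains every $321$-avoiding permutation of length $n$ as a pattern (an $S_n(321)$-superpattern).
   Context: A permutation $\pi$ of length $k$ is a pattern of a permutation $\sigma$ if there are indices $\ell_1<\cdots<\ell_k$ with $\pi_i<\pi_j$ iff $\sigma_{\ell_i}<\sigma_{\ell_j}$. $S_n(321)$ denotes the set of permutations of $\{1,\dots,n\}$ that do not contain $321$ as a pattern. A $P$-superpattern is a permutation containing every permutation of the set $P$ as a pattern. *)

(* Defs.v *)
From mathcomp Require Import all_boot all_fingroup.
Set Implicit Arguments. Unset Strict Implicit. Unset Printing Implicit Defensive.

Definition contains_pattern (m k : nat) (sigma : 'S_m) (pi : 'S_k) : Prop :=
  exists l : 'I_k -> 'I_m,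
    (forall i j : 'I_k, i < j -> l i < l j) /\
    (forall i j : 'I_k, (pi i < pi j) = (sigma (l i) < sigma (l j))).

(* The pattern 321 as a permutation of {0,1,2}: 0 |-> 2, 1 |-> 1, 2 |-> 0. *)
Definition p321 : 'S_3 := perm (@rev_ord_inj 3).

Definition avoids321 (n : nat) (pi : 'S_n) : Prop := ~ contains_pattern pi p321.

Definition superpattern321 (m n : nat) (sigma : 'S_m) : Prop :=
  forall pi : 'S_n, avoids321 pi -> contains_pattern sigma pi.

(* Main.v *)
(** Let [w = floor (sqrt n) + 1]. Cut the positions of a 321-avoiding [pi] into
    columns: the column starting at [x] ends at [x + w], or after the last entry
    smaller than some entry left of [x] if that is further right. There are at most
    [w] columns, and entries two columns apart are never inverted, so only
    consecutive columns overlap vertically. In each column the entries below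
    something further left form an increasing lower cell, those above something
    further right an increasing upper cell, and the remaining middle cell is nonempty
    only in columns of width [w]. The upper cell of a column shares a band of rows
    with the lower cell of the next one.

    In a run of large columns, the horizontal and vertical orders between
    consecutive cells amalgamate into one acyclic relation, so a single coordinate
    [pos] below [(3w+1)(w+1)] can be used in both directions: a large cell needs only
    the diagonal. A column of width [w] breaks the run; at its two outer cells [pos]
    is a multiple of [w+1], so these cells are full grids of [w] by [3w+1] points. A
    run meets at most [2w] entries of such outer cells, which is what keeps the
    multiples of [w+1] affordable. The construction has [15 w^3 + O(w^2)] points, and
    is padded up to [22 w^3 + 6 w^2]. *)
Require Import Defs.
From mathcomp Require Import all_boot all_fingroup zify.
From Stdlib Require Import Reals Lra.

Set Implicit Arguments. Unset Strict Implicit. Unset Printing Implicit Defensive.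

(** * Breaking ties between coordinates *)

Section Standardization.

Variable T : finType.

Lemma rank_ltE (k : T -> nat) (s t : T) : injective k ->
  (#|[set z | k z < k s]| < #|[set z | k z < k t]|) = (k s < k t).
Proof.
move=> k_inj; case: (ltnP (k s) (k t)) => [lt_st | le_ts].
  apply/proper_card/properP; split.
    by apply/subsetP=> z; rewrite !inE => /ltn_trans; apply.
  by exists s; rewrite !inE ?ltnn.
apply/negbTE; rewrite -leqNgt; apply/subset_leq_card/subsetP=> z.
by rewrite !inE => /leq_trans; apply.
Qed.

(** Scaling by [#|T|] and adding an enumeration index breaks ties without disturbing strict
    inequalities; the rank counts the smaller keys. *)
Lemma exists_rank (k : T -> nat) :
  exists2 r : T -> 'I_#|T|, injective r & forall s t, k s < k t -> r s < r t.
Proof.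
pose k' t := k t * #|T| + enum_rank t.
have k'_lt s t : k s < k t -> k' s < k' t.
  move=> lt_st; apply: (@leq_trans ((k s).+1 * #|T|)).
    by rewrite /k' mulSn addnC ltn_add2r ltn_ord.
  by rewrite (leq_trans _ (leq_addr _ _)) // leq_mul2r lt_st orbT.
have k'_inj : injective k'.
  move=> s t eq_st; have [lt_st|lt_ts|eq_k] := ltngtP (k s) (k t).
  - by have := k'_lt _ _ lt_st; rewrite eq_st ltnn.
  - by have := k'_lt _ _ lt_ts; rewrite eq_st ltnn.
  by apply/enum_rank_inj/val_inj; move: eq_st; rewrite /k' eq_k => /addnI.
have r_lt t : #|[set z | k' z < k' t]| < #|T|.
  rewrite -cardsT; apply/proper_card/properP; split; first exact: subsetT.
  by exists t; rewrite !inE ?ltnn.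
exists (fun t => Ordinal (r_lt t)) => [s t [eq_st] | s t /k'_lt lt_st] /=.
  have := rank_ltE s t k'_inj; have := rank_ltE t s k'_inj.
  rewrite eq_st ltnn => /esym/negbT; rewrite -leqNgt => le_st.
  move=> /esym/negbT; rewrite -leqNgt => le_ts.
  by apply: k'_inj; apply/eqP; rewrite eqn_leq le_st le_ts.
by rewrite rank_ltE.
Qed.

(* Points given by integer coordinates form a permutation once ties between
   coordinates are broken; only strict comparisons survive the tie-breaking. *)
Lemma standardization (kx ky : T -> nat) :
  exists sigma : 'S_#|T|, forall (k : nat) (pi : 'S_k) (phi : 'I_k -> T),
    (forall i j : 'I_k, i < j -> kx (phi i) < kx (phi j)) ->
    (forall i j : 'I_k, pi i < pi j -> ky (phi i) < ky (phi j)) ->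
    contains_pattern sigma pi.
Proof.
have [rx rx_inj rx_lt] := exists_rank kx; have [ry ry_inj ry_lt] := exists_rank ky.
have [g rxK gK] : bijective rx by apply: inj_card_bij; rewrite // card_ord.
have s_inj : injective (ry \o g) by apply: inj_comp => //; apply: can_inj gK.
exists (perm s_inj) => k pi phi phi_x phi_y; exists (rx \o phi); split=> i j.
  by move/phi_x/rx_lt.
rewrite !permE /= !rxK.
have [lt_ij|lt_ji|/val_inj/perm_inj ->] := ltngtP (pi i) (pi j); last by rewrite ltnn.
  by rewrite ry_lt ?phi_y.
by apply/esym/negbTE; rewrite -leqNgt ltnW ?ry_lt ?phi_y.
Qed.

End Standardization.

Lemma padded_standardization (T : finType) (m : nat) (kx ky : T -> nat) :
  #|T| <= m ->
  exists sigma : 'S_m, forall (k : nat) (pi : 'S_k) (phi : 'I_k -> T),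
    (forall i j : 'I_k, i < j -> kx (phi i) < kx (phi j)) ->
    (forall i j : 'I_k, pi i < pi j -> ky (phi i) < ky (phi j)) ->
    contains_pattern sigma pi.
Proof.
move=> le_Tm; pose T' : finType := (T + 'I_(m - #|T|))%type.
have <- : #|T'| = m by rewrite card_sum card_ord subnKC.
pose ext (k : T -> nat) (t : T') := if t is inl s then k s else 0.
have [sigma sigmaP] := standardization (ext kx) (ext ky).
by exists sigma => k pi phi; apply: (sigmaP k pi (fun i => inl (phi i))).
Qed.

(** * Acyclicity along a chain of cells *)

(* Cells numbered by [kappa] along a chain, with [R] a strict order on each pair of
   consecutive cells: such orders amalgamate without creating a cycle. *)
Section ChainOfCells.

Variables (T : finType) (kappa : T -> nat) (R : rel T).

Hypothesis R_near : forall a b, R a b ->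
  (kappa a <= (kappa b).+1) && (kappa b <= (kappa a).+1).
Hypothesis R_trans : forall k a b c,
  k <= kappa a <= k.+1 -> k <= kappa b <= k.+1 -> k <= kappa c <= k.+1 ->
  R a b -> R b c -> R a c.

(** Discrete intermediate values: a step changes [kappa] by at most one. *)
Lemma path_crosses (k : nat) (x : T) (q : seq T) :
  path R x q -> (kappa x <= k <= kappa (last x q)) || (kappa (last x q) <= k <= kappa x) ->
  exists q1 y q2, [/\ x :: q = q1 ++ y :: q2 & kappa y = k].
Proof.
elim: q x => [|y q IHq] x /=; first by move=> _ near; exists [::], x, [::]; split=> //; lia.
case/andP=> Rxy path_q near; have [eq_xk|ne_xk] := eqVneq (kappa x) k.
  by exists [::], x, (y :: q).
have [|q1 [z [q2 [-> eq_zk]]]] := IHq _ path_q; first by have := R_near Rxy; lia.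
by exists (x :: q1), z, q2.
Qed.

(** Induction on length. If [x] is near the endpoint [b], collapse the tail and compose within two
    levels. Otherwise [x] and [b] lie on opposite sides of the level of [a], so the path returns to
    that level at some [z]; collapse both halves there. *)
Lemma path_collapse (a x : T) (q : seq T) :
  path R a (x :: q) ->
  (kappa a <= (kappa (last x q)).+1) && (kappa (last x q) <= (kappa a).+1) ->
  R a (last x q).
Proof.
have [m] := ubnP (size q); elim: m a x q => // m IHm a x q lt_qm path_xq near.
case: q lt_qm path_xq near => [|y q] lt_qm; first by rewrite /= andbT.
set b := last x (y :: q) => path_yq near.
have /= /andP[Rax path_x] := path_yq; have near_ax := R_near Rax.
have [near_xb|far_xb] := boolP ((kappa x <= (kappa b).+1) && (kappa b <= (kappa x).+1)).
  have Rxb : R x b by apply: (IHm x y q).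
  by apply: (R_trans (k := minn (kappa a) (minn (kappa x) (kappa b)))) Rax Rxb; lia.
have crosses : (kappa x <= kappa a <= kappa b) || (kappa b <= kappa a <= kappa x) by lia.
have [q1 [z [q2 [def_q eq_za]]]] := @path_crosses _ x (y :: q) path_x crosses.
have def_b : b = last z q2 by rewrite /b -[last x _]/(last a (x :: y :: q)) def_q last_cat.
have /andP[path_q1 path_q2] : path R a (rcons q1 z) && path R z q2.
  by move: path_yq; rewrite def_q -cat_rcons cat_path last_rcons.
have size_q : size q1 + size q2 = (size q).+1.
  by have := congr1 size def_q; rewrite size_cat /= addnS => -[].
case: q2 => [|c q2] in def_q def_b path_q2 size_q *.
  by move: far_xb; rewrite def_b /= eq_za; lia.
have Rzb : R z b.
  have := IHm z c q2; rewrite -[last c q2]/(last z (c :: q2)) -def_b eq_za.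
  by apply=> //; rewrite /= in size_q lt_qm; lia.
have Raz : R a z.
  case: q1 => [|d q1] in def_q path_q1 size_q *.
    by have := path_q1; rewrite /= andbT.
  have := IHm a d (rcons q1 z); rewrite last_rcons; apply=> //.
    by rewrite size_rcons; rewrite /= in size_q lt_qm; lia.
  by rewrite eq_za; lia.
by apply: (R_trans (k := minn (kappa a) (kappa b))) Raz Rzb; lia.
Qed.

Lemma chain_acyclic : irreflexive R -> forall a b, R a b -> ~~ connect R b a.
Proof.
move=> R_irr a b Rab; apply/negP=> /connectP[q path_q def_a].
have : R a a by rewrite {2}def_a; apply: path_collapse; rewrite /= -?def_a ?Rab //; lia.
by rewrite R_irr.
Qed.

End ChainOfCells.

(** * Columns, cells and rows of a 321-avoiding permutation *)

Lemma avoids321P (n : nat) (pi : 'S_n) (i j k : 'I_n) :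
  avoids321 pi -> i < j -> j < k -> pi k < pi j -> pi i < pi j.
Proof.
move=> no321 lt_ij lt_jk lt_pi; rewrite ltnNge; apply/negP=> le_pi.
have {le_pi} lt_pi' : pi j < pi i.
  rewrite ltn_neqAle le_pi andbT; apply/eqP=> /val_inj/perm_inj eq_ji.
  by rewrite eq_ji ltnn in lt_ij.
apply: no321; exists (tnth [tuple i; j; k]); split=> a b.
  by case: a b => [[|[|[|//]]] ?] [[|[|[|//]]] ?] //= _; rewrite !(tnth_nth i) //=; lia.
rewrite !permE.
by case: a b => [[|[|[|//]]] ?] [[|[|[|//]]] ?] //=; rewrite !(tnth_nth i) //=; lia.
Qed.

Section Decomposition.

Variables (n w : nat) (pi : 'S_n).
Hypothesis w_gt0 : 0 < w.

Lemma pi_neq (i j : 'I_n) : i < j -> pi i != pi j :> nat.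
Proof. by move=> lt_ij; apply/eqP=> /val_inj/perm_inj eq_ij; rewrite eq_ij ltnn in lt_ij. Qed.

(** The successor makes this an exclusive end, with 0 for the empty maximum. *)
Definition crossed (x : nat) : nat :=
  \max_(e : 'I_n | [exists i : 'I_n, (i < x) && (pi e < pi i)]) e.+1.

Fixpoint cut (j : nat) : nat :=
  if j is j'.+1 then maxn (cut j' + w) (crossed (cut j')) else 0.

Lemma leq_cut (j : nat) : cut j + w <= cut j.+1.
Proof. exact: leq_maxl. Qed.

Lemma cut_ge (j : nat) : j * w <= cut j.
Proof. by elim: j => // j IHj; have := leq_cut j; lia. Qed.

Lemma cut_homo : {homo cut : j k / j <= k}.
Proof. by apply: homo_leq => // [j k l|j]; [apply: leq_trans | have := leq_cut j; lia]. Qed.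

Lemma cut_separates (j : nat) (i e : 'I_n) : i < cut j -> cut j.+1 <= e -> pi i < pi e.
Proof.
move=> lt_ij le_je; have lt_ie : i < e by have := leq_cut j; lia.
have := pi_neq lt_ie; case: ltngtP => // lt_ei _.
have : e.+1 <= crossed (cut j).
  by apply: (@leq_bigmax_cond _ _ (fun e : 'I_n => e.+1)); apply/existsP; exists i; rewrite lt_ij.
by rewrite leqNgt ltnS (leq_trans _ le_je) // leq_maxr.
Qed.

Lemma exists_col (e : nat) : exists j, e < cut j.+1.
Proof. by exists e; apply: leq_trans (cut_ge _); apply: leq_pmulr. Qed.

Definition col (e : nat) : nat := ex_minn (exists_col e).

Lemma colP (e : nat) : cut (col e) <= e < cut (col e).+1.
Proof.
rewrite /col; case: ex_minnP => j -> min_j; rewrite andbT.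
by case: j min_j => // j min_j; rewrite leqNgt; apply/negP=> /min_j; rewrite ltnn.
Qed.

Lemma col_homo : {homo col : d e / d <= e}.
Proof.
move=> d e le_de; rewrite {1}/col; case: ex_minnP => j _; apply.
by have /andP[_] := colP e; lia.
Qed.

Definition large (j : nat) : bool := cut j + w < cut j.+1.

Definition low (e : 'I_n) : bool :=
  [exists i : 'I_n, (i < cut (col e)) && (pi e < pi i)].

Definition upp (e : 'I_n) : bool :=
  [exists i : 'I_n, (cut (col e).+1 <= i) && (pi i < pi e)].

(* Lower, middle and upper cell are numbered 0, 1 and 2, so that the upper cell of
   a column and the lower cell of the next one get the same [row]. *)
Definition kind (e : 'I_n) : nat :=
  if low e then 0 else if upp e || large (col e) then 2 else 1.

Definition row (e : 'I_n) : nat := (col e).*2 + kind e.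

Lemma kind_le2 (e : 'I_n) : kind e <= 2.
Proof. by rewrite /kind; case: ifP => // _; case: ifP. Qed.

Lemma large_kind (e : 'I_n) : large (col e) -> kind e != 1.
Proof. by rewrite /kind => ->; rewrite orbT; case: ifP. Qed.

Hypothesis no321 : avoids321 pi.

(** An entry both [low] and [upp] would be the middle of a 321. *)
Lemma upp_kind (e : 'I_n) : upp e -> kind e = 2.
Proof.
rewrite /kind => upp_e; rewrite upp_e /=; case: ifP => // /existsP[i /andP[lt_i lt_ei]].
case/existsP: upp_e => k /andP[le_k lt_ke]; have /andP[le_e lt_e] := colP e.
have := avoids321P no321 (leq_trans lt_i le_e) (leq_trans lt_e le_k) lt_ke.
by rewrite ltnNge ltnW.
Qed.

Lemma large_last (j : nat) : large j ->
  exists g i : 'I_n, [/\ i < cut j, pi g < pi i & g.+1 = cut j.+1].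
Proof.
rewrite /large /= leq_max ltnn /= => lt_crossed.
have -> : maxn (cut j + w) (crossed (cut j)) = crossed (cut j) by lia.
have : 0 < #|[pred e : 'I_n | [exists i : 'I_n, (i < cut j) && (pi e < pi i)]]|.
  rewrite lt0n; apply: contraTneq lt_crossed => /card0_eq no_e.
  by rewrite /crossed big_pred0 // => e; have := no_e e; rewrite inE.
case/(@eq_bigmax_cond _ _ (fun e : 'I_n => e.+1)) => g.
rewrite inE => /existsP[i /andP[lt_i lt_gi]] max_g.
by exists g, i.
Qed.

(** A descent would extend to a 321, by a larger entry before the column for lower cells and by a
    smaller one after it for upper cells. In a large column the final entry [g] is the smaller one:
    it lies below some [i] left of the column, hence below every entry that is not [low]. *)
Lemma cell_increasing (d e : 'I_n) :
  col d = col e -> kind d = kind e -> kind e != 1 -> d < e -> pi d < pi e.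
Proof.
move=> eq_col; rewrite /kind -eq_col.
have [/existsP[i /andP[lt_i lt_di]] | low_d] := boolP (low d).
  have [low_e _ _ lt_de|_] := boolP (low e); last by case: ifP.
  have := pi_neq lt_de; case: ltngtP => // lt_ed _.
  have /andP[le_d _] := colP d.
  by have := avoids321P no321 (leq_trans lt_i le_d) lt_de lt_ed; rewrite ltnNge ltnW.
have [low_e|low_e] := boolP (low e); first by case: ifP.
have /andP[le_e lt_e] := colP e.
case: (boolP (large _)) => [lg_d _ _ lt_de | _]; last first.
  rewrite !orbF; case: (upp d); have [/existsP[k /andP[le_k lt_ke]]|_] // := boolP (upp e).
  by move=> _ _ lt_de; apply: avoids321P lt_ke => //; apply: leq_trans le_k.
have [g [i [lt_i lt_gi def_g]]] := large_last lg_d.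
have lt_ge : pi g < pi e.
  move/existsPn: low_e => /(_ i); rewrite -eq_col lt_i /= -leqNgt; exact: leq_trans.
have lt_eg : e < g.
  rewrite ltn_neqAle -ltnS def_g eq_col lt_e andbT.
  by apply/eqP=> /val_inj eq_eg; rewrite eq_eg ltnn in lt_ge.
exact: avoids321P lt_ge.
Qed.

(** An inversion between adjacent columns makes [d] upper and [e] lower, which puts them in the same
    row. Within a column, the witness for [low] or [upp] separates the two values. *)
Lemma row_lt (d e : 'I_n) : row d < row e -> pi d < pi e.
Proof.
move=> lt_row; have := kind_le2 d; have := kind_le2 e => kd ke.
have le_col : col d <= col e by move: lt_row; rewrite /row; lia.
have [/andP[le_d lt_d] /andP[le_e lt_e]] := (colP d, colP e).
have [lt_col2|] := ltnP (col d).+1 (col e).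
  by apply: cut_separates lt_d (leq_trans _ le_e); apply: cut_homo.
rewrite leq_eqVlt => /predU1P[eq_col|lt_col]; last first.
  have eq_col : col d = col e by lia.
  have {lt_row} : kind d < kind e by move: lt_row; rewrite /row eq_col ltn_add2l.
  rewrite /kind -eq_col.
  have [/existsP[i /andP[lt_i lt_di]]|low_d] := boolP (low d).
    have [//|/existsPn/(_ i)] := boolP (low e).
    rewrite -eq_col lt_i /= -leqNgt => le_ie _; exact: leq_trans le_ie.
  case: (low e) => //; case: (large _); rewrite ?orbT // !orbF.
  have [/existsP[k /andP[le_k lt_ke]]|_] := boolP (upp e); last by case: (upp d).
  have [//|/existsPn/(_ k)] := boolP (upp d).
  rewrite eq_col le_k /= -leqNgt => le_dk _; exact: leq_ltn_trans lt_ke.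
have lt_de : d < e by rewrite eq_col in le_e; lia.
have := pi_neq lt_de; case: ltngtP => // lt_ed _.
have upp_d : upp d by apply/existsP; exists e; rewrite -eq_col le_e.
have low_e : low e by apply/existsP; exists d; rewrite eq_col lt_d.
by move: lt_row; rewrite /row (upp_kind upp_d) [kind e]/kind low_e eq_col; lia.
Qed.

(** * The acyclic order on the outer cells *)

Definition linked (d e : 'I_n) : bool :=
  [&& kind d != 1, kind e != 1 &
      ((col d == col e) && (d < e)) || ((row d == row e) && (pi d < pi e))].

(** For outer cells, levels [k] and [k + 1] form a column when [k] is even and share a row when [k]
    is odd. *)
Definition kappa (e : 'I_n) : nat := (col e).*2 + (kind e == 2).

(** Entries of one column that also share a row lie in one increasing cell, where both orders
    agree. *)
Lemma linked_col (d e : 'I_n) : linked d e -> col d = col e -> d < e.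
Proof.
case/and3P=> kd ke /orP[/andP[_ //]|/andP[/eqP eq_row lt_de]] eq_col.
have eq_kind : kind d = kind e by move: eq_row; rewrite /row eq_col => /addnI.
rewrite ltnNge leq_eqVlt; apply/negP=> /predU1P[/val_inj eq_de|lt_ed].
  by rewrite eq_de ltnn in lt_de.
by have := cell_increasing (esym eq_col) (esym eq_kind) kd lt_ed; rewrite ltnNge ltnW.
Qed.

Lemma linked_row (d e : 'I_n) : linked d e -> row d = row e -> pi d < pi e.
Proof.
case/and3P=> kd ke /orP[/andP[/eqP eq_col lt_de]|/andP[_ //]] eq_row.
by apply: cell_increasing => //; move: eq_row; rewrite /row eq_col => /addnI.
Qed.

Lemma linked_near (d e : 'I_n) : linked d e ->
  (kappa d <= (kappa e).+1) && (kappa e <= (kappa d).+1).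
Proof.
case/and3P=> kd ke; have := kind_le2 d; have := kind_le2 e; rewrite /row /kappa.
by move=> kd2 ke2 /orP[/andP[/eqP-> _]|/andP[/eqP eq_row _]]; lia.
Qed.

Lemma linked_trans (k : nat) (a b c : 'I_n) :
  k <= kappa a <= k.+1 -> k <= kappa b <= k.+1 -> k <= kappa c <= k.+1 ->
  linked a b -> linked b c -> linked a c.
Proof.
move=> ka kb kc ab bc; have /and3P[ka1 kb1 _] := ab; have /and3P[_ kc1 _] := bc.
have := kind_le2 a; have := kind_le2 b; have := kind_le2 c => kc2 kb2 ka2.
rewrite /linked ka1 kc1 /=; rewrite /kappa in ka kb kc.
have [k_odd|k_even] := boolP (odd k).
  have [eq_ab eq_bc] : row a = row b /\ row b = row c by rewrite /row; lia.
  have lt_ab := linked_row ab eq_ab; have lt_bc := linked_row bc eq_bc.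
  by rewrite eq_ab eq_bc eqxx (ltn_trans lt_ab lt_bc) orbT.
have [eq_ab eq_bc] : col a = col b /\ col b = col c by lia.
have lt_ab := linked_col ab eq_ab; have lt_bc := linked_col bc eq_bc.
by rewrite eq_ab eq_bc eqxx (ltn_trans lt_ab lt_bc).
Qed.

(* Unlike [linked], the columns of width [w] impose no order here: in [points]
   their two coordinates are chosen independently. *)
Definition step (d e : 'I_n) : bool :=
  [&& kind d != 1, kind e != 1 &
      [&& col d == col e, large (col d) & d < e] || ((row d == row e) && (pi d < pi e))].

Lemma sub_step_linked : subrel step linked.
Proof.
move=> d e /and3P[kd ke de]; rewrite /linked kd ke /=.
by case/orP: de => [/and3P[-> _ ->]|->]; rewrite ?orbT.
Qed.

Lemma step_acyclic (d e : 'I_n) : step d e -> ~~ connect step e d.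
Proof.
move=> /sub_step_linked de.
have irr : irreflexive linked by move=> a; rewrite /linked !ltnn !andbF.
apply: contra (chain_acyclic linked_near linked_trans irr de).
by apply: connect_sub => a b /sub_step_linked/connect1.
Qed.

(** * The common coordinate [pos] *)

Definition nlarge (e : 'I_n) : nat := #|[set d | connect step d e & large (col d)]|.

Definition nsmall (e : 'I_n) : nat :=
  #|[set d | connect step d e & (kind d != 1) && ~~ large (col d)]|.

Definition block (e : 'I_n) : nat := nlarge e %/ w + nsmall e.

Definition pos (e : 'I_n) : nat :=
  block e * w.+1 + (if large (col e) then (nlarge e %% w).+1 else 0).

Lemma card_preds_leq (P : pred 'I_n) (d e : 'I_n) : step d e ->
  #|[set a | connect step a d & P a]| <= #|[set a | connect step a e & P a]|.
Proof.
move=> de; apply/subset_leq_card/subsetP=> a; rewrite !inE => /andP[ad ->].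
by rewrite (connect_trans ad (connect1 de)).
Qed.

Lemma card_preds_lt (P : pred 'I_n) (d e : 'I_n) : step d e -> P e ->
  #|[set a | connect step a d & P a]| < #|[set a | connect step a e & P a]|.
Proof.
move=> de Pe; apply/proper_card/properP; split.
  apply/subsetP=> a; rewrite !inE => /andP[ad ->].
  by rewrite (connect_trans ad (connect1 de)).
by exists e; rewrite inE Pe ?connect0 // (negbTE (step_acyclic de)).
Qed.

(** A step into a large column raises [nlarge], hence the block or the offset within it; a step into
    a small one raises [nsmall], hence the block. Offsets never exceed [w], so a higher block always
    wins. *)
Lemma pos_lt (d e : 'I_n) : step d e -> pos d < pos e.
Proof.
move=> de; have le_l : nlarge d <= nlarge e := card_preds_leq (fun a => large (col a)) de.
have le_s : nsmall d <= nsmall e :=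
  card_preds_leq (fun a => (kind a != 1) && ~~ large (col a)) de.
have le_div := leq_div2r w le_l.
have lt_mod := ltn_pmod (nlarge d) w_gt0.
rewrite /pos /block; case: (boolP (large (col e))) => [lg_e | sm_e].
  have lt_l : nlarge d < nlarge e := card_preds_lt (P := fun a => large (col a)) de lg_e.
  have [eq_b|ne_b] := eqVneq (nlarge d %/ w + nsmall d) (nlarge e %/ w + nsmall e).
    have eq_div : nlarge d %/ w = nlarge e %/ w by lia.
    rewrite eq_b ltn_add2l ltnS; case: ifP => // _.
    move: lt_l; rewrite {1}(divn_eq (nlarge d) w) {1}(divn_eq (nlarge e) w) eq_div.
    by rewrite ltn_add2l.
  by case: ifP => _; nia.
have lt_s : nsmall d < nsmall e.
  apply: (card_preds_lt (P := fun a => (kind a != 1) && ~~ large (col a))) => //.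
  by rewrite sm_e andbT; case/and3P: de.
by case: ifP => _; nia.
Qed.

(** * Runs and the bound on small predecessors *)

Definition nsmall_before (j : nat) : nat := \sum_(i < j) ~~ large i.

Lemma nsmall_beforeS (j : nat) : nsmall_before j.+1 = nsmall_before j + ~~ large j.
Proof. exact: big_ord_recr. Qed.

Lemma nsmall_before_homo : {homo nsmall_before : j k / j <= k}.
Proof.
by apply: homo_leq => // [j k l|j]; [apply: leq_trans | rewrite nsmall_beforeS leq_addr].
Qed.

Lemma nsmall_before_inj (j k : nat) : ~~ large j -> ~~ large k ->
  nsmall_before j = nsmall_before k -> j = k.
Proof.
move=> sm_j sm_k eq_jk; have [lt_jk|lt_kj|//] := ltngtP j k.
  by have := nsmall_before_homo lt_jk; rewrite nsmall_beforeS sm_j eq_jk; lia.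
by have := nsmall_before_homo lt_kj; rewrite nsmall_beforeS sm_k eq_jk; lia.
Qed.

(* A run is a maximal block of consecutive large columns, together with the
   upper cell of the small column before it and the lower cell of the one after. *)
Definition run (e : 'I_n) : nat :=
  nsmall_before (col e) + (~~ large (col e) && (kind e == 2)).

Lemma step_run (d e : 'I_n) : step d e -> run d = run e.
Proof.
case/and3P=> kd ke /orP[/and3P[/eqP eq_col lg_d _]|/andP[/eqP eq_row _]].
  by rewrite /run -eq_col lg_d.
have := kind_le2 d; have := kind_le2 e; move: eq_row; rewrite /row /run => eq_row ke2 kd2.
have [[eq_c eq_k]|[[eq_c eq_k]|[eq_c eq_k]]] :
    (col d = col e /\ kind d = kind e) \/
    ((col e = (col d).+1 /\ (kind d = 2 /\ kind e = 0)) \/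
     (col d = (col e).+1 /\ (kind e = 2 /\ kind d = 0))) by lia.
- by rewrite eq_c eq_k.
- by case: eq_k => -> ->; rewrite eq_c nsmall_beforeS !andbT !andbF addn0.
by case: eq_k => -> ->; rewrite eq_c nsmall_beforeS !andbT !andbF addn0.
Qed.

Lemma connect_run (d e : 'I_n) : connect step d e -> run d = run e.
Proof.
by case/connectP=> q path_q ->; elim: q d path_q => //= a q IHq d /andP[/step_run-> /IHq].
Qed.

Lemma small_offset_lt (e : 'I_n) : ~~ large (col e) -> e - cut (col e) < w.
Proof. by rewrite /large -leqNgt; have := colP e; lia. Qed.

Lemma card_small_col (A : {set 'I_n}) : {in A &, forall d e : 'I_n, col d = col e} ->
  {in A, forall e : 'I_n, ~~ large (col e)} -> #|A| <= w.
Proof.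
move=> same_col small_A; pose off (e : 'I_n) : 'I_w := insubd (Ordinal w_gt0) (e - cut (col e)).
have offE e : e \in A -> off e = e - cut (col e) :> nat.
  by move/small_A/small_offset_lt => lt_w; rewrite /off val_insubd lt_w.
rewrite -[w in _ <= w]card_ord -(@card_in_imset _ _ off) ?max_card // => d e dA eA eq_off.
have := congr1 (@nat_of_ord _) eq_off; rewrite !offE // (same_col d e) //.
have := colP d; have := colP e; rewrite (same_col d e) // => de ee eq_sub.
by apply: val_inj => /=; lia.
Qed.

(** All predecessors share the run of [e], which meets at most one lower and one upper cell of small
    columns, each with at most [w] entries. *)
Lemma nsmall_le (e : 'I_n) : nsmall e <= w + w.
Proof.
pose A k := [set d | [&& connect step d e, kind d == k & ~~ large (col d)]].
have cardA k : k != 1 -> #|A k| <= w.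
  move=> k_ne1; apply: card_small_col => [a b|a]; rewrite !inE; last by case/and3P.
  case/and3P=> /connect_run run_a /eqP kind_a sm_a.
  case/and3P=> /connect_run run_b /eqP kind_b sm_b.
  apply: nsmall_before_inj => //.
  by move: run_a; rewrite -run_b /run kind_a kind_b sm_a sm_b => /addIn.
apply: leq_trans (leq_add (cardA 0 isT) (cardA 2 isT)).
apply: leq_trans (leq_card_setU _ _); apply/subset_leq_card/subsetP=> d.
rewrite !inE => /and3P[-> kd ->]; rewrite !andbT /=.
by have := kind_le2 d; lia.
Qed.

(** Middle cells need not be increasing, so their heights come from a plain rank by value instead of
    [pos]. *)
Definition mid_rank (e : 'I_n) : nat :=
  #|[set d : 'I_n | (col d == col e) && (pi d < pi e)]|.

Lemma mid_rank_lt (d e : 'I_n) : col d = col e -> pi d < pi e -> mid_rank d < mid_rank e.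
Proof.
move=> eq_col lt_de; apply/proper_card/properP; split.
  by apply/subsetP=> a; rewrite !inE eq_col => /andP[-> /ltn_trans]; apply.
by exists d; rewrite !inE ?ltnn ?andbF // eq_col eqxx.
Qed.

Lemma mid_rank_le (e : 'I_n) : ~~ large (col e) -> mid_rank e <= w.
Proof.
move=> sm_e; apply: card_small_col => [a b|a]; rewrite !inE.
  by case/andP=> /eqP-> _ /andP[/eqP->].
by case/andP=> /eqP->.
Qed.

(** * Bounds and final coordinates of the entries *)

Hypothesis n_le_w2 : n <= w * w.

Lemma col_lt (e : 'I_n) : col e < w.
Proof.
have /andP[le_e _] := colP e; rewrite ltnNge; apply/negP=> /cut_homo.
by have := cut_ge w; have := ltn_ord e; lia.
Qed.

(** At most [w * w] large predecessors contribute [w] blocks, the small ones [2 * w]. *)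
Lemma block_le (e : 'I_n) : block e <= 3 * w.
Proof.
have le_l : nlarge e <= w * w by rewrite (leq_trans (max_card _)) // card_ord.
have := leq_div2r w le_l; rewrite mulnK // => le_div.
by have := nsmall_le e; rewrite /block; lia.
Qed.

Lemma pos_bound (e : 'I_n) : pos e < (3 * w).+1 * w.+1.
Proof.
by have := block_le e; have := ltn_pmod (nlarge e) w_gt0; rewrite /pos; case: ifP; nia.
Qed.

Definition xkey (e : 'I_n) : nat :=
  col e * ((3 * w).+1 * w.+1) + (if large (col e) then pos e else e - cut (col e)).

Definition ykey (e : 'I_n) : nat :=
  row e * ((3 * w).+1 * w.+1) + (if kind e == 1 then mid_rank e * w.+1 else pos e).

Lemma xkey_lt (d e : 'I_n) : d < e -> xkey d < xkey e.
Proof.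
move=> lt_de; have := col_homo (ltnW lt_de); rewrite leq_eqVlt => /predU1P[eq_col|lt_col].
  rewrite /xkey -eq_col ltn_add2l; case: (boolP (large _)) => lg_d.
    by apply: pos_lt; rewrite /step !large_kind -?eq_col //= eqxx lg_d lt_de.
  by have := colP d; lia.
apply: (@leq_trans ((col d).+1 * ((3 * w).+1 * w.+1))).
  rewrite /xkey [(col d).+1 * _]mulSn addnC ltn_add2r; case: (boolP (large _)) => lg_d;
    first exact: pos_bound.
  by have := small_offset_lt lg_d; nia.
by rewrite (leq_trans _ (leq_addr _ _)) // leq_mul2r lt_col orbT.
Qed.

Lemma ykey_lt (d e : 'I_n) : pi d < pi e -> ykey d < ykey e.
Proof.
move=> lt_de; have [lt_row|lt_row|eq_row] := ltngtP (row d) (row e).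
- apply: (@leq_trans ((row d).+1 * ((3 * w).+1 * w.+1))).
    rewrite /ykey [(row d).+1 * _]mulSn addnC ltn_add2r; case: (boolP (kind d == 1)) => kd;
      last exact: pos_bound.
    have sm_d : ~~ large (col d) by apply: contraL kd => /large_kind.
    by have := mid_rank_le sm_d; nia.
  by rewrite (leq_trans _ (leq_addr _ _)) // leq_mul2r lt_row orbT.
- by have := row_lt lt_row; rewrite ltnNge ltnW.
rewrite /ykey -eq_row ltn_add2l.
have [ke2 kd2] := (kind_le2 e, kind_le2 d).
case: (boolP (kind d == 1)) => kd; have := eq_row; rewrite /row => eq_row'.
  have [eq_k eq_c] : kind e = 1 /\ col d = col e by lia.
  by rewrite eq_k /= ltn_mul2r mid_rank_lt.
have ke : kind e != 1 by lia.
by rewrite (negbTE ke); apply: pos_lt; rewrite /step kd ke eq_row eqxx lt_de orbT.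
Qed.

End Decomposition.

(** * The universal point set *)

(** Each column holds points for both of its possible sizes: three grids for the cells of a small
    column, and two diagonals, lower for [false] and upper for [true], for a large one. *)
Definition points (w : nat) : finType :=
  ('I_w * ('I_3 * 'I_w * 'I_(3 * w).+1 + bool * 'I_((3 * w).+1 * w.+1)))%type.

Definition xcoord (w : nat) (t : points w) : nat :=
  t.1 * ((3 * w).+1 * w.+1) +
  match t.2 with inl (_, r, _) => nat_of_ord r | inr (_, p) => nat_of_ord p end.

Definition ycoord (w : nat) (t : points w) : nat :=
  match t.2 with
  | inl (k, _, u) => (t.1.*2 + k) * ((3 * w).+1 * w.+1) + u * w.+1
  | inr (b, p) => (t.1.*2 + b.*2) * ((3 * w).+1 * w.+1) + p
  end.

Lemma card_points (w : nat) : #|points w| = 15 * (w * w * w) + 11 * (w * w) + 2 * w.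
Proof.
by rewrite card_prod card_sum !card_prod !card_ord card_bool; lia.
Qed.

Lemma exists_point (n w : nat) (pi : 'S_n) (w_gt0 : 0 < w) (e : 'I_n) :
  n <= w * w ->
  exists2 t : points w, xcoord t = xkey pi w_gt0 e & ycoord t = ykey pi w_gt0 e.
Proof.
move=> n_le; pose j := Ordinal (col_lt pi w_gt0 n_le e).
case: (boolP (large w pi (col pi w_gt0 e))) => [lg_e | sm_e].
  exists (j, inr (kind pi w_gt0 e == 2, Ordinal (pos_bound pi w_gt0 n_le e))).
    by rewrite /xcoord /xkey lg_e.
  rewrite /ycoord /ykey /row (negbTE (large_kind lg_e)) /=.
  by have := large_kind lg_e; have := kind_le2 pi w_gt0 e; case: (kind _ _ _) => [|[|[]]].
have k_lt : kind pi w_gt0 e < 3 := kind_le2 pi w_gt0 e.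
(* In a small column [pos] is [block] times [w + 1], so [block] indexes the grid line. *)
pose u := if kind pi w_gt0 e == 1 then mid_rank pi w_gt0 e else block pi w_gt0 e.
have u_lt : u < (3 * w).+1.
  rewrite /u; case: ifP => _; rewrite ltnS ?block_le //.
  by have := mid_rank_le sm_e; lia.
exists (j, inl (Ordinal k_lt, Ordinal (small_offset_lt sm_e), Ordinal u_lt)).
  by rewrite /xcoord /xkey (negbTE sm_e).
by rewrite /ycoord /ykey /u /pos (negbTE sm_e) addn0 /=; case: ifP.
Qed.

Lemma exists_superpattern321 (w n m : nat) :
  0 < w -> n <= w * w -> 15 * (w * w * w) + 11 * (w * w) + 2 * w <= m ->
  exists sigma : 'S_m, superpattern321 n sigma.
Proof.
rewrite -card_points => w_gt0 n_le le_m.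
have [sigma sigmaP] := padded_standardization (@xcoord w) (@ycoord w) le_m.
exists sigma => pi no321.
have [phi phi_x phi_y] := fin_all_exists2 (fun e => exists_point pi w_gt0 e n_le).
apply: (sigmaP n pi phi) => d e; rewrite ?phi_x ?phi_y; first exact: xkey_lt.
exact: ykey_lt.
Qed.

(** * Asymptotics of the length *)

Open Scope R_scope.

(* There is a length function L(n) = 22 n^{3/2} + Theta(n) such that for every
   positive integer n some permutation of length L(n) is an S_n(321)-superpattern. *)
Theorem theorem6 :
  exists L : nat -> nat,
    (forall n : nat, (0 < n)%nat ->
       exists sigma : 'S_(L n), superpattern321 n sigma) /\
    (exists c1 c2 : R, 0 < c1 /\ 0 < c2 /\
       exists N : nat, forall n : nat, (N <= n)%nat ->
         c1 * INR n <= INR (L n) - 22 * INR n * sqrt (INR n) <= c2 * INR n).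
Proof.
pose w n := (Nat.sqrt n).+1.
exists (fun n => 22 * (w n * w n * w n) + 6 * (w n * w n))%nat; split.
  move=> n _; apply: (@exists_superpattern321 (w n)) => //.
    by have := Nat.sqrt_spec' n; rewrite /w; lia.
  (* For [w >= 1], [11 w^2 + 2 w <= 7 w^3 + 6 w^2]. *)
  by have : (0 < w n)%nat by []; nia.
(* With [s = sqrt n] and [s <= w <= s + 1], the excess over [22 s^3] is at least [6 s^2] and at most
   [72 s^2 + 78 s + 28], which is at most [178 s^2] as [s >= 1]. *)
exists 6, 178; split; [lra | split; [lra | exists 1%nat => n n_gt0]].
have -> : INR (22 * (w n * w n * w n) + 6 * (w n * w n))%nat
    = 22 * (INR (w n) * INR (w n) * INR (w n)) + 6 * (INR (w n) * INR (w n)).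
  by rewrite plus_INR !mult_INR; congr (_ * _ + _ * _); rewrite INR_IZR_INZ.
have n_ge1 : 1 <= INR n by apply: (le_INR 1); apply/leP.
have sqrtK : sqrt (INR n) * sqrt (INR n) = INR n by apply: sqrt_sqrt; lra.
have w_ge1 : 1 <= INR (w n) by apply: (le_INR 1); apply/leP.
have s_le_w : sqrt (INR n) <= INR (w n).
  rewrite -[INR (w n)]sqrt_square; last lra.
  apply: sqrt_le_1_alt; rewrite -mult_INR; apply: le_INR.
  by have := Nat.sqrt_spec' n; rewrite /w; lia.
have w_le_s : INR (w n) <= sqrt (INR n) + 1.
  rewrite /w S_INR; apply: Rplus_le_compat_r.
  rewrite -[INR (Nat.sqrt n)]sqrt_square; last exact: pos_INR.
  apply: sqrt_le_1_alt; rewrite -mult_INR; apply: le_INR.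
  by have := Nat.sqrt_spec' n; lia.
have s_ge1 : 1 <= sqrt (INR n) by rewrite -sqrt_1; apply: sqrt_le_1_alt.
move: (sqrt _) (INR (w n)) sqrtK s_ge1 s_le_w w_le_s => s v <- s_ge1 s_le_v v_le_s.
have sq_le : s * s <= v * v by nra.
have sq_ge : v * v <= s * s + 2 * s + 1 by nra.
have cube_le : s * s * s <= v * v * v by apply: Rmult_le_compat; nra.
split; first lra.
have : v * v * v <= (s * s + 2 * s + 1) * (s + 1) by apply: Rmult_le_compat; nra.
nra.
Qed.
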